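(* Let $X$ be a real Banach space. Then the following statements are equivalent. (i) For each non-empty closed convex subset $V$ of $X$ and each non-empty compact subset $F$ of $X$, $\mathrm{rad}_{V}(F)=\mathrm{rad}_{X}(F)+d(V,\mathrm{cent}_{X}(F))$. (ii) For each non-empty closed convex subset $V$ of $X$ and each non-empty compact subset $F$ of $X$, $\mathrm{rad}_{V}(F)=\mathrm{rad}_{X}(F)+\lim_{\delta\to0^{+}}d(V,\mathrm{cent}_{X}(F,\delta))$. (iii) For each non-empty closed convex subset $V$ of $X$ and each non-empty finite subset $F$ of $X$, $\mathrm{rad}_{V}(F)=\mathrm{rad}_{X}(F)+d(V,\mathrm{cent}_{X}(F))$.
   Context: For a non-empty closed bounded $B\subseteq X$, a non-empty closed convex $V\subseteq X$ (possibly $V=X$), $x\in X$ and $\delta>0$, put $r(x,B)=\sup\{\|x-b\|:b\in B\}$, $\mathrm{rad}_{V}(B)=\inf_{v\in V}r(v,B)$, $\mathrm{cent}_{V}(B)=\{v\in V:r(v,B)=\mathrm{rad}_{V}(B)\}$, and $\mathrm{cent}_{V}(B,\delta)=\{v\in V:r(v,B)\le\mathrm{rad}_{V}(B)+\delta\}$. For $A,B\subseteq X$, $d(A,B)=\inf\{\|a-b\|:a\in A,\ b\in B\}$, with the usual convention $\inf\emptyset=+\infty$. *)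

(* Defs.v *)
From mathcomp Require Import all_boot all_order all_algebra.
From mathcomp Require Import all_classical all_reals all_analysis.
Import Order.TTheory GRing.Theory Num.Theory.
Import numFieldNormedType.Exports.

Set Implicit Arguments.
Unset Strict Implicit.
Unset Printing Implicit Defensive.

Local Open Scope classical_set_scope.
Local Open Scope ring_scope.

(* All suprema, infima and distances are taken in [\bar R], where
   [ereal_inf set0 = +oo].  For [B] bounded and [B], [V] nonempty, [farthest]
   and [crad] are finite, hence agree with the corresponding real numbers. *)

Definition farthest (R : realType) (X : normedModType R)
    (x : X) (B : set X) : \bar R :=
  ereal_sup [set (`|x - b|)%:E | b in B].

Definition crad (R : realType) (X : normedModType R) (V B : set X) : \bar R :=
  ereal_inf [set farthest v B | v in V].

Definition cent (R : realType) (X : normedModType R) (V B : set X) : set X :=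
  [set v | V v /\ farthest v B = crad V B].

Definition near_cent (R : realType) (X : normedModType R)
    (V B : set X) (delta : R) : set X :=
  [set v | V v /\ (farthest v B <= crad V B + delta%:E)%E].

Definition set_dist (R : realType) (X : normedModType R)
    (A B : set X) : \bar R :=
  ereal_inf [set (`|a - b|)%:E | a in A & b in B].

(* The limit in [\bar R] always exists, since [near_cent V B] grows with
   [delta]; it may be [+oo]. *)
Lemma near_cent_dist_is_cvg (R : realType) (X : normedModType R)
    (W V B : set X) :
  cvg (set_dist W (near_cent V B delta) @[delta --> 0^'+]).
Proof.
apply: nonincreasing_at_right_is_cvge; near=> e => x y _ _ xy.
apply: ereal_inf_le_tmp => _ [a Wa [b [Vb bd] <-]]; exists a => //.
exists b => //; split=> //; apply: le_trans bd _.
by rewrite leeD2l// lee_fin.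
Unshelve. all: by end_near. Qed.

(* Main.v *)
Require Import Defs.
From mathcomp Require Import all_boot all_order all_algebra.
From mathcomp Require Import all_classical all_reals all_analysis.
From mathcomp Require Import finmap lra.
Import Order.TTheory GRing.Theory Num.Theory.
Import numFieldNormedType.Exports.

Set Implicit Arguments.
Unset Strict Implicit.
Unset Printing Implicit Defensive.

Local Open Scope classical_set_scope.
Local Open Scope ring_scope.

(* The radius formula for a singleton [V = {x}] says
    [d(x, cent F) = r(x, F) - rad F].  Since [r(., F)] is 1-Lipschitz, one
    inequality always holds, and the formula for arbitrary [V] is the infimum of
    the formulas for its points.  The other inequality is equivalent to its
    approximate form "for all [x] and [e > 0] there is [y] with
    [r(y) <= rad F + e] and [|x - y| <= r(x) - rad F + e]": iterating with
    [e / 2^n] gives a Cauchy sequence whose limit is a center.  The approximate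
    form passes from finite [e]-nets of a compact [F] to [F]. *)

Section Farthest.
Context {R : realType} {X : normedModType R}.
Implicit Types (x y v : X) (V F G : set X).
Local Open Scope ereal_scope.

(** * Lipschitz bound and finiteness of the radii *)

Lemma farthest_le_addl x y F : farthest x F <= farthest y F + `|x - y|%:E.
Proof.
apply/ereal_supP => _ [b Fb <-].
apply: (@le_trans _ _ (`|y - b|%:E + `|x - y|%:E)).
  by rewrite -EFinD lee_fin [leRHS]addrC ler_distD.
by apply: leeD2r; apply: ereal_sup_ubound; exists b.
Qed.

Lemma farthest_ge0 x F : F !=set0 -> 0 <= farthest x F.
Proof.
case=> b Fb; apply: le_ereal_sup_tmp.
by exists `|x - b|%:E; [exists b|rewrite lee_fin].
Qed.

Lemma farthest_fin_num x F : F !=set0 -> compact F -> farthest x F \is a fin_num.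
Proof.
move=> F0 /compact_bounded[M [_ HM]].
rewrite ge0_fin_numE ?farthest_ge0//.
apply: (@le_lt_trans _ _ (`|x| + (M + 1))%:E); last by rewrite ltry.
apply/ereal_supP => _ [b Fb <-]; rewrite lee_fin.
apply: le_trans (ler_normB _ _) _; rewrite lerD2l.
by apply: HM => //; rewrite ltrDl.
Qed.

Lemma crad_le_farthest v V F : V v -> crad V F <= farthest v F.
Proof. by move=> Vv; apply: ereal_inf_lbound; exists v. Qed.

Lemma crad1 v F : crad [set v] F = farthest v F.
Proof. by rewrite /crad image_set1 ereal_inf1. Qed.

Lemma crad_fin_num V F :
  V !=set0 -> F !=set0 -> compact F -> crad V F \is a fin_num.
Proof.
move=> [v Vv] F0 cF; rewrite ge0_fin_numE; last first.
  by apply/ereal_infP => _ [w _ <-]; exact: farthest_ge0.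
apply: le_lt_trans (crad_le_farthest F Vv) _.
by rewrite -ge0_fin_numE ?farthest_fin_num ?farthest_ge0.
Qed.

(** * Radii compared with distances to near-centers *)

Lemma crad_le_near_cent V F (e : R) :
  crad setT F \is a fin_num ->
  crad V F <= crad setT F + e%:E + set_dist V (near_cent setT F e).
Proof.
move=> rF; rewrite -leeBlDl; last by rewrite fin_numD rF.
apply/ereal_infP => _ [v Vv [c [_ cF] <-]].
rewrite leeBlDl; last by rewrite fin_numD rF.
apply: le_trans (crad_le_farthest F Vv) _.
by apply: le_trans (farthest_le_addl v c F) _; apply: leeD2r.
Qed.

(** Near-centers shrink with the tolerance, so the distance to them can only grow as [d] decreases
    below [e]. *)
Lemma near_cent_dist_le_lim V F (e : R) : (0 < e)%R ->
  set_dist V (near_cent setT F e) <=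
  lim (set_dist V (near_cent setT F d) @[d --> 0^'+]).
Proof.
move=> e0; apply: lime_ge; first exact: near_cent_dist_is_cvg.
near=> d; apply: ereal_inf_le_tmp => _ [a Va [b [_ bd] <-]].
exists a => //; exists b => //; split=> //; apply: le_trans bd _.
by rewrite leeD2l// lee_fin; near: d; exact: nbhs_right_le.
Unshelve. all: by end_near. Qed.

Lemma crad_le_lim_near_cent V F : crad setT F \is a fin_num ->
  crad V F <= crad setT F
    + lim (set_dist V (near_cent setT F d) @[d --> 0^'+]).
Proof.
move=> rF; apply/lee_addgt0Pr => e e0.
apply: le_trans (crad_le_near_cent V e rF) _.
by rewrite addeAC leeD2r// leeD2l// near_cent_dist_le_lim.
Qed.

Lemma lim_near_cent_dist_le V F :
  lim (set_dist V (near_cent setT F d) @[d --> 0^'+]) <=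
  set_dist V (cent setT F).
Proof.
apply: lime_le; first exact: near_cent_dist_is_cvg.
near=> d; apply: ereal_inf_le_tmp => _ [a Va [b [_ br] <-]].
exists a => //; exists b => //; split=> //; rewrite br leeDl// lee_fin.
by apply/ltW; near: d; exact: nbhs_right_gt.
Unshelve. all: by end_near. Qed.

(* The radius formula for a singleton [V], up to [e]. *)
Definition near_steep F := forall x (e : R), (0 < e)%R -> exists y,
  farthest y F <= crad setT F + e%:E /\
  crad setT F + `|x - y|%:E <= farthest x F + e%:E.

Lemma lim_formula_near_steep F : crad setT F \is a fin_num ->
  (forall x, farthest x F \is a fin_num) ->
  (forall x, crad [set x] F = crad setT F
    + lim (set_dist [set x] (near_cent setT F d) @[d --> 0^'+])) ->
  near_steep F.
Proof.
move=> rF fF H x e e0.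
have le_d : crad setT F + set_dist [set x] (near_cent setT F e) <= farthest x F.
  by rewrite -crad1 H leeD2l// near_cent_dist_le_lim.
(* The slack [e] makes the bound on the infimum strict, so some near-center attains it; both radii
   must be finite here. *)
have : set_dist [set x] (near_cent setT F e) < farthest x F - crad setT F + e%:E.
  rewrite -leeBrDl// in le_d.
  by apply: le_lt_trans le_d _; rewrite lteDl ?fin_numB ?fF ?rF ?lte_fin.
move=> /ereal_inf_lt[_ [a -> [y [_ yF] <-]] xy]; exists y; split=> //.
by move: (ltW xy); rewrite addeAC leeBrDl.
Qed.

Lemma crad_add_dist_le V F : crad setT F \is a fin_num ->
  (forall x (e : R), (0 < e)%R -> exists c, cent setT F c /\
     crad setT F + `|x - c|%:E <= farthest x F + e%:E) ->
  crad setT F + set_dist V (cent setT F) <= crad V F.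
Proof.
move=> rF H; apply/ereal_infP => _ [v Vv <-]; apply/lee_addgt0Pr => e e0.
have [c [cF vc]] := H v e e0; apply: le_trans vc; apply: leeD2l.
by apply: ereal_inf_lbound; exists v => //; exists c.
Qed.

(** * From finite sets to compact sets *)

Lemma compact_finite_net F (e : R) : (0 < e)%R -> F !=set0 -> compact F ->
  exists G, [/\ finite_set G, G !=set0, G `<=` F &
    forall a, F a -> exists2 b, G b & (`|a - b| <= e)%R].
Proof.
move=> e0 [a0 Fa0]; rewrite compact_cover => cF.
have [||D DF FD] := cF X F (fun x => ball x e).
- by move=> x _; exact: ball_open.
- by move=> x Fx; exists x => //; exact: ballxx.
have net a : F a -> exists2 b, [set` D] b & (`|a - b| <= e)%R.
  move=> /FD[b Db]; rewrite -ball_normE /= => ba.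
  by exists b => //; rewrite distrC ltW.
exists [set` D]; split=> //.
- by have [b Db _] := net _ Fa0; exists b.
- by move=> x /DF /set_mem.
Qed.

Lemma farthest_sub x F G : G `<=` F -> farthest x G <= farthest x F.
Proof. by move=> GF; apply: ereal_sup_le; exact: image_subset. Qed.

Lemma farthest_net x F G (e : R) :
  (forall a, F a -> exists2 b, G b & (`|a - b| <= e)%R) ->
  farthest x F <= farthest x G + e%:E.
Proof.
move=> net; apply/ereal_supP => _ [a /net[b Gb ab] <-].
apply: (@le_trans _ _ (`|x - b|%:E + e%:E)).
  rewrite -EFinD lee_fin (le_trans (ler_distD b _ _))// lerD2l.
  by rewrite distrC.
by apply: leeD2r; apply: ereal_sup_ubound; exists b.
Qed.

Lemma near_steep_compact F : F !=set0 -> compact F ->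
  (forall G, G !=set0 -> finite_set G -> near_steep G) -> near_steep F.
Proof.
move=> F0 cF H x e e0.
(* One half of [e] pays for replacing [F] by its net [G], the other for the error in
   [near_steep G]. *)
have e2 : (0 < e / 2)%R by rewrite divr_gt0.
have [G [finG G0 GF net]] := compact_finite_net e2 F0 cF.
have [y [yG xy]] := H G G0 finG x _ e2.
have rGF : crad setT G <= crad setT F.
  apply/ereal_infP => _ [v _ <-].
  by apply: le_trans (crad_le_farthest _ _) (farthest_sub v GF).
have rFG : crad setT F <= crad setT G + (e / 2)%:E.
  rewrite -leeBlDr//; apply/ereal_infP => _ [v _ <-]; rewrite leeBlDr//.
  by apply: le_trans (crad_le_farthest _ _) (farthest_net v net).
have ee : e%:E = (e / 2)%:E + (e / 2)%:E by rewrite -EFinD -splitr.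
exists y; split.
  apply: le_trans (farthest_net y net) _.
  by rewrite ee addeA leeD2r// (le_trans yG)// leeD2r.
apply: (@le_trans _ _ (crad setT G + (e / 2)%:E + `|x - y|%:E)).
  exact: leeD2r.
rewrite addeAC ee addeA leeD2r// (le_trans xy)// leeD2r//.
exact: farthest_sub.
Qed.

End Farthest.

(** * From near-centers to centers by completeness *)

Lemma sublevel_error_bound (R : realType) (X : completeNormedModType R)
    (f : X -> R) (rho : R) :
  (forall x y, f x <= f y + `|x - y|) ->
  (forall x e, 0 < e -> exists y,
     f y <= rho + e /\ rho + `|x - y| <= f x + e) ->
  forall x e, 0 < e -> exists c, f c <= rho /\ rho + `|x - c| <= f x + e.
Proof.
move=> lipf H x e e0.
(* With this choice the limit lies within [4 * eps 0 = e / 2] of [y 0], and the first step from [x]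
   costs [eps 0 = e / 8]; the sum stays below [e]. *)
pose eps n : R := e / 8 * 2^-1 ^+ n.
have epsS n : eps n = 2 * eps n.+1.
  by rewrite /eps exprS mulrCA [2 * (_ * _)]mulrA divff ?mul1r// mulrCA.
have eps0 n : 0 < eps n by rewrite mulr_gt0 ?exprn_gt0 ?invr_gt0 ?divr_gt0.
have eps_cvg : eps n @[n --> \oo] --> (0 : R).
  by apply: cvg_geometric; rewrite ger0_norm ?invf_lt1 ?ltr1n// invr_ge0.
have eps_small d : 0 < d -> \forall n \near \oo, eps n < d.
  exact: cvgr_lt eps_cvg d.
pose nxt n z := projT1 (cid (H z (eps n) (eps0 n))).
have nxtP n z : f (nxt n z) <= rho + eps n /\ rho + `|z - nxt n z| <= f z + eps n.
  exact: projT2 (cid (H z (eps n) (eps0 n))).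
pose fix y n := if n is m.+1 then nxt m.+1 (y m) else nxt 0%N x.
have fy n : f (y n) <= rho + eps n by case: n => [|n]; exact: (nxtP _ _).1.
have y_step n : rho + `|y n - y n.+1| <= f (y n) + eps n.+1 := (nxtP _ _).2.
(* A step from [y k] has length at most [eps k + eps k.+1 = 3 * eps k.+1], which is below
   [4 * (eps k - eps k.+1)]; these bounds telescope. *)
have yy n m : `|y n - y (n + m)%N| <= 4 * (eps n - eps (n + m)%N).
  elim: m => [|m IH]; first by rewrite addn0 !subrr normr0 mulr0.
  rewrite addnS.
  have := ler_distD (y (n + m)%N) (y n) (y (n + m).+1).
  have := y_step (n + m)%N; have := fy (n + m)%N; have := epsS (n + m)%N.
  by have := eps0 (n + m).+1; move: IH; lra.
have yle n m : (n <= m)%N -> `|y n - y m| <= 4 * eps n.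
  move=> nm; rewrite -(subnKC nm); apply: le_trans (yy _ _) _.
  by rewrite ler_pM2l// lerBlDr lerDl ltW.
have /cauchy_cvgP ycvg : cauchy (y @ \oo).
  apply: cauchy_exP => d d0.
  have [|n _ /(_ n (leqnn n)) nd] := eps_small (d / 4); first by rewrite divr_gt0.
  exists (y n), n => // m nm; rewrite -ball_normE /=.
  by apply: le_lt_trans (yle _ _ nm) _; move: nd; lra.
pose c := lim (y @ \oo).
have yc n : `|y n - c| <= 4 * eps n.
  apply: (closed_cvg (closed_ball_ Num.norm (y n) (4 * eps n))
    (@closed_closed_ball_ _ _ _ _) _ c ycvg).
  by near=> m; apply: yle; near: m; exact: nbhs_infty_ge.
exists c; split.
  apply/ler_addgt0Pr => d d0.
  (* [f c] exceeds [rho] by at most [eps n] from [fy] plus [4 * eps n] from the Lipschitz bound. *)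
  have [|n _ /(_ n (leqnn n)) nd] := eps_small (d / 5); first by rewrite divr_gt0.
  by move: nd; have := lipf c (y n); rewrite distrC; have := fy n; have := yc n; lra.
have [_] := nxtP 0%N x; rewrite -/(y 0%N).
have := ler_distD (y 0%N) x c; have := yc 0%N.
rewrite /eps expr0 mulr1; lra.
Unshelve. all: by end_near. Qed.

(** All radii involved are finite, so the real-valued iteration applies to [fine (farthest z F)].
    Its limit has [farthest] at most [crad setT F], and the reverse inequality always holds, so it
    is an exact center. *)
Lemma near_steep_center (R : realType) (X : completeNormedModType R)
    (F : set X) : F !=set0 -> compact F -> near_steep F ->
  forall x (e : R), 0 < e -> exists c, cent setT F c /\
     (crad setT F + `|x - c|%:E <= farthest x F + e%:E)%E.
Proof.
move=> F0 cF sF x e e0.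
have rE : crad setT F = (fine (crad setT F))%:E.
  by rewrite fineK// crad_fin_num//; exists point.
have fE z : farthest z F = (fine (farthest z F))%:E.
  by rewrite fineK// farthest_fin_num.
have [||c [fc xc]] := @sublevel_error_bound R X
    (fun z => fine (farthest z F)) (fine (crad setT F)) _ _ x e e0.
- by move=> z w; rewrite -lee_fin EFinD -!fE farthest_le_addl.
- move=> z d /(sF z)[w [wF zw]]; exists w.
  by rewrite -!lee_fin !EFinD -!fE -rE.
exists c; rewrite -!lee_fin !EFinD -!fE -rE in fc xc; split=> //; split=> //.
by apply/eqP; rewrite eq_le fc crad_le_farthest.
Qed.

Theorem corollary3p14 (R : realType) (X : completeNormedModType R) :
  let stmt_i :=
    forall V F : set X,
      V !=set0 -> closed V -> convex_set V -> F !=set0 -> compact F ->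
      crad V F = (crad setT F + set_dist V (cent setT F))%E in
  let stmt_ii :=
    forall V F : set X,
      V !=set0 -> closed V -> convex_set V -> F !=set0 -> compact F ->
      crad V F = (crad setT F
        + lim (set_dist V (near_cent setT F delta) @[delta --> 0^'+]))%E in
  let stmt_iii :=
    forall V F : set X,
      V !=set0 -> closed V -> convex_set V -> F !=set0 -> finite_set F ->
      crad V F = (crad setT F + set_dist V (cent setT F))%E in
  (stmt_i <-> stmt_ii) /\ (stmt_ii <-> stmt_iii).
Proof.
move=> stmt_i stmt_ii stmt_iii.
have rF (F : set X) : F !=set0 -> compact F -> crad setT F \is a fin_num.
  by apply: crad_fin_num; exists point.
(* The limit is squeezed: [crad_le_lim_near_cent] bounds it from below, and the distance to exact
   centers bounds it from above. *)
have lim_of_cent (V F : set X) : F !=set0 -> compact F ->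
    crad V F = (crad setT F + set_dist V (cent setT F))%E ->
    crad V F = (crad setT F
      + lim (set_dist V (near_cent setT F delta) @[delta --> 0^'+]))%E.
  move=> F0 cF VF; apply/eqP; rewrite eq_le crad_le_lim_near_cent ?rF//=.
  by rewrite [leRHS]VF leeD2l// lim_near_cent_dist_le.
(* Only singletons [V] are tested; they are closed and convex. Keeping [F] fixed lets this serve
   both compact sets and finite nets. *)
have steep_of_lim (F : set X) : F !=set0 -> compact F ->
    (forall V, V !=set0 -> closed V -> convex_set V ->
      crad V F = (crad setT F
        + lim (set_dist V (near_cent setT F delta) @[delta --> 0^'+]))%E) ->
    near_steep F.
  move=> F0 cF VF; apply: lim_formula_near_steep; first exact: rF.
    by move=> x; exact: farthest_fin_num.
  move=> x; apply: VF; first by exists x.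
    exact/accessible_closed_set1/hausdorff_accessible/norm_hausdorff.
  by move=> a b l /set_mem-> /set_mem->; rewrite convmm; exact/mem_set.
have i_of_steep : (forall F : set X, F !=set0 -> compact F -> near_steep F) ->
    stmt_i.
  move=> sF V F V0 _ _ F0 cF; apply/eqP; rewrite eq_le crad_add_dist_le ?rF//.
    rewrite andbT; apply: le_trans (crad_le_lim_near_cent V (rF F F0 cF)) _.
    by rewrite leeD2l// lim_near_cent_dist_le.
  by apply: near_steep_center => //; exact: sF.
have i_ii : stmt_i -> stmt_ii.
  by move=> i V F *; apply: lim_of_cent => //; exact: i.
have ii_i : stmt_ii -> stmt_i.
  move=> ii; apply: i_of_steep => F F0 cF.
  by apply: steep_of_lim => // V *; exact: ii.
(* On a finite [G] the formula with exact centers implies the one with limits, hence [near_steep G];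
   nets then carry this to compact [F]. *)
have iii_i : stmt_iii -> stmt_i.
  move=> iii; apply: i_of_steep => F F0 cF; apply: near_steep_compact => // G G0 fG.
  have cG := finite_compact fG.
  by apply: steep_of_lim => // V *; apply: lim_of_cent => //; exact: iii.
split; split=> //.
  (* Finite sets are compact, so (iii) is a special case of (i). *)
  move=> ii V F V0 cV vV F0 /finite_compact; exact: (ii_i ii).
by move=> /iii_i/i_ii.
Qed.
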